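(* Let $\mathcal{O}_{K,S}$ be a ring of $S$-integers in a number field $K$ and $\ell$ a prime such that $\mathcal{O}_{K,S}$ is a principal ideal domain, $\mathcal{O}_{K,S}[\zeta_\ell]$ is a Dedekind domain, and $[K(\zeta_\ell):K]=2$. Let $M$ be the $\mathcal{O}_{K,S}[\mathrm{C}_\ell]$-module associated to a $\mathrm{C}_\ell$-subgroup of $\mathrm{GL}_3(\mathcal{O}_{K,S})$, such that $M\otimes_{\mathcal{O}_{K,S}}K\cong K\times K(\zeta_\ell)$ as a representation of $\mathrm{C}_\ell$. Denoting by $c\in\mathcal{O}_{K,S}[\zeta_\ell]/(\zeta_\ell-1)$ an element defining the unipotent action on $M$, set $$\mathcal{O}_{K,S}[\zeta_\ell]^\times\times^c_{\mathrm{End}(\mathcal{O}_{K,S}/(\ell))}\mathcal{O}_{K,S}^\times=\{(\phi,\psi)\in\mathcal{O}_{K,S}[\zeta_\ell]^\times\times\mathcal{O}_{K,S}^\times\mid\overline{\phi}c=c\overline{\psi}\text{ in }\mathrm{End}(\mathcal{O}_{K,S}/(\ell))\}.$$ Then the morphism $\mathrm{Aut}_{\mathcal{O}_{K,S}[\mathrm{C}_\ell]}(M)\to\mathcal{O}_{K,S}[\zeta_\ell]^\times\times\mathcal{O}_{K,S}^\times$, sending an automorphism to the pair of automorphisms it induces on $M_{\mathrm{N}}$ and $M/M_{\mathrm{N}}$, factors through an isomorphism $$\mathrm{Aut}_{\mathcal{O}_{K,S}[\mathrm{C}_\ell]}(M)\to\mathcal{O}_{K,S}[\zeta_\ell]^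\times\times^c_{\mathrm{End}(\mathcal{O}_{K,S}/(\ell))}\mathcal{O}_{K,S}^\times.$$
   Context: $S$ is a finite set of places containing the infinite ones, $\mathrm{C}_\ell=\langle\gamma\rangle$ is cyclic of order $\ell$, $\zeta_\ell$ is a primitive $\ell$-th root of unity, $\mathrm{N}=\sum_{g\in\mathrm{C}_\ell}[g]$, and $M_{\mathrm{N}}=\{m\in M\mid\mathrm{N}m=0\}$. The module associated to $\iota\colon\mathrm{C}_\ell\hookrightarrow\mathrm{GL}_3(\mathcal{O}_{K,S})$ is $\mathcal{O}_{K,S}^{\oplus 3}$ with $\mathrm{C}_\ell$ acting through $\iota$. Here $M_{\mathrm{N}}$ is isomorphic to a fractional ideal $\mathfrak{a}$ of $\mathcal{O}_{K,S}[\zeta_\ell]$, $M/M_{\mathrm{N}}$ has $\mathcal{O}_{K,S}$-rank 1 and trivial action, and $\mathrm{Aut}(M_{\mathrm{N}})\cong\mathcal{O}_{K,S}[\zeta_\ell]^\times$, $\mathrm{Aut}(M/M_{\mathrm{N}})\cong\mathcal{O}_{K,S}^\times$ (acting by multiplication). As $\mathcal{O}_{K,S}$-module $M=\mathfrak{a}\oplus\mathcal{O}_{K,S}y$; $\gamma$ acts by $\zeta_\ell$ on $\mathfrak{a}$ and by $y\mapsto y+\beta$ with $\beta\in\mathfrak{a}$; the element $c$ is the class of $\beta$ in $\mathfrak{a}/(\zeta_\ell-1)\mathfrak{a}\cong\mathcal{O}_{K,S}[\zeta_\ell]/(\zeta_\ell-1)$. The ring $\mathcal{O}_{K,S}[\zeta_\ell]/(\zeta_\ell-1)$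 is identified with $\mathcal{O}_{K,S}/(\ell)$; $\overline{\phi}$ is the reduction of $\phi$ modulo $\zeta_\ell-1$, $\overline{\psi}$ the reduction of $\psi$ modulo $\ell$, and $c,\overline{\phi},\overline{\psi}$ are viewed as multiplication endomorphisms of $\mathcal{O}_{K,S}/(\ell)$.
   Formalization: Since O[ζ]/(ζ−1) need not be O/(ℓ) (e.g. K=Q(√5), ℓ=5, O=O_K gives F_5), the condition φ̄c=cψ̄ is stated as an equality of maps O/(ℓ)→O[ζ]/(ζ−1) rather than in End(O/(ℓ)); the two agree whenever the identification holds. *)

(* Defs.v *)
From HB Require Import structures.
From mathcomp Require Import all_boot all_order all_algebra all_fingroup.
From mathcomp Require Import all_field all_character.
From mathcomp Require Import boolp classical_sets functions reals exp.

Set Implicit Arguments.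
Unset Strict Implicit.
Unset Printing Implicit Defensive.

Import Order.TTheory GRing.Theory Num.Theory.
Local Open Scope ring_scope.
Local Open Scope classical_set_scope.
Local Open Scope quotient_scope.

Record subfring (F : fieldType) (P : subringClosed F) :=
  SubFRing { sfval : F; sfvalP : sfval \in P }.
Arguments sfval {F P} s.

Section SubFRing.
Variables (F : fieldType) (P : subringClosed F).

HB.instance Definition _ := [isSub of subfring P for @sfval F P].
HB.instance Definition _ := [Choice of subfring P by <:].
HB.instance Definition _ := [SubChoice_isSubComNzRing of subfring P by <:].

Lemma sfval_zmod : zmod_morphism (@sfval F P).
Proof. exact: (rmorphB (\val : subfring P -> F)). Qed.
Lemma sfval_monoid : monoid_morphism (@sfval F P).
Proof.
by split; [exact: (rmorph1 (\val : subfring P -> F))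
         | exact: (rmorphM (\val : subfring P -> F))].
Qed.

HB.instance Definition _ :=
  GRing.isZmodMorphism.Build (subfring P) F (@sfval F P) sfval_zmod.
HB.instance Definition _ :=
  GRing.isMonoidMorphism.Build (subfring P) F (@sfval F P) sfval_monoid.

Definition sf_unit : pred (subfring P) :=
  fun x => (sfval x != 0) && ((sfval x)^-1 \in P).

Definition sf_inv (x : subfring P) : subfring P :=
  if sf_unit x then insubd x (sfval x)^-1 else x.

Lemma sf_mulVx : {in sf_unit, left_inverse 1 sf_inv *%R}.
Proof.
move=> x ux; have /andP[x0 xP] := ux; apply: val_inj.
have -> : sf_inv x = insubd x (sfval x)^-1 by rewrite /sf_inv ifT.
by rewrite [val (_ * _)]rmorphM /= insubdK //= mulVf.
Qed.

Lemma sf_unitPl (x y : subfring P) : y * x = 1 -> sf_unit x.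
Proof.
move=> /(congr1 val); rewrite rmorphM /= => yx1.
have x0 : sfval x != 0.
  by apply/eqP => x0; move: yx1; rewrite x0 mulr0 => /esym/eqP; rewrite oner_eq0.
apply/andP; split=> //.
by rewrite -[_^-1]mul1r -yx1 mulfK //; case: y {yx1}.
Qed.

Lemma sf_inv_out : {in [predC sf_unit], sf_inv =1 id}.
Proof. by move=> x /negPf ux; rewrite /sf_inv ifF. Qed.

HB.instance Definition _ := GRing.ComNzRing_hasMulInverse.Build (subfring P)
  sf_mulVx sf_unitPl sf_inv_out.

Lemma sf_idomain (x y : subfring P) : x * y = 0 -> (x == 0) || (y == 0).
Proof.
move=> /(congr1 val); rewrite rmorphM /= => /eqP.
by rewrite mulf_eq0 -!val_eqE.
Qed.

HB.instance Definition _ :=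
  GRing.ComUnitRing_isIntegral.Build (subfring P) sf_idomain.

End SubFRing.

Record absval (R : realType) (K : fieldType) := AbsVal {
  av_fun :> K -> R;
  av_ge0 : forall x, 0 <= av_fun x;
  av_eq0 : forall x, (av_fun x == 0) = (x == 0);
  av_mul : forall x y, av_fun (x * y) = av_fun x * av_fun y;
  av_add : forall x y, av_fun (x + y) <= av_fun x + av_fun y }.

Section Places.
Variables (R : realType) (K : fieldType).
Implicit Types v w : absval R K.

Definition av_nontrivial v := exists2 x : K, x != 0 & v x != 1.

Definition av_equiv v w := exists2 s : R, 0 < s & forall x, w x = v x `^ s.

Definition av_ultrametric v := forall x y, v (x + y) <= Num.max (v x) (v y).

End Places.

(* A place is an equivalence class of nontrivial absolute values, so a finite
   set of places is a finite family of representatives.  The infinite places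
   of a number field are the archimedean ones. *)
Record place_set (R : realType) (K : fieldType) := PlaceSet {
  ps_size : nat;
  ps_rep : 'I_ps_size -> absval R K;
  ps_nontrivial : forall i, av_nontrivial (ps_rep i);
  ps_infinite : forall v, av_nontrivial v -> ~ av_ultrametric v ->
    exists i, av_equiv (ps_rep i) v }.

Arguments ps_rep {R K} p.
Arguments ps_infinite {R K} p v.

Section SIntegers.
Variables (R : realType) (K : fieldType) (S : place_set R K).

Definition in_places (v : absval R K) := exists i, av_equiv (ps_rep S i) v.

Definition Sint_pred : {pred K} :=
  fun x => `[< forall v, av_nontrivial v -> ~ in_places v -> v x <= 1 >].

Lemma av1 (v : absval R K) : v 1 = 1.
Proof.
have /eqP : v 1 * v 1 = v 1 * 1 by rewrite -av_mul !mulr1.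
by rewrite -subr_eq0 -mulrBr mulf_eq0 av_eq0 oner_eq0 subr_eq0 => /eqP.
Qed.

Lemma avN (v : absval R K) x : v (- x) = v x.
Proof.
have vN1 : v (-1) = 1.
  have /eqP : v (-1) ^+ 2 = 1 by rewrite expr2 -av_mul mulrNN mulr1 av1.
  rewrite sqrf_eq1 => /orP[/eqP //|/eqP vN1].
  by have := av_ge0 v (-1); rewrite vN1 oppr_ge0 leNgt ltr01.
by rewrite -mulN1r av_mul vN1 mul1r.
Qed.

Lemma Sint_subring : subring_closed Sint_pred.
Proof.
split=> [|x y /asboolP xS /asboolP yS|x y /asboolP xS /asboolP yS].
- by apply/asboolP => v _ _; rewrite av1.
- apply/asboolP => v nv vS.
  have um : av_ultrametric v by apply: contrapT => /(ps_infinite S v nv).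
  by rewrite (le_trans (um _ _))// avN ge_max xS ?yS.
- apply/asboolP => v nv vS; rewrite av_mul mulr_ile1 ?av_ge0 //.
    exact: xS.
  exact: yS.
Qed.

HB.instance Definition _ := GRing.isSubringClosed.Build K Sint_pred Sint_subring.

Definition Sint := subfring Sint_pred.

End SIntegers.

Section Adjoin.
Variables (K : fieldType) (L : fieldExtType K) (P : subringClosed K) (z : L).

Definition adjoin_pred : {pred L} :=
  fun x => `[< exists2 p : {poly K}, p \is a polyOver P &
                 x = (map_poly (in_alg L) p).[z] >].

Lemma adjoin_subring : subring_closed adjoin_pred.
Proof.
split=> [|x y|x y].
- by apply/asboolP; exists 1; rewrite ?rpred1 // rmorph1 hornerE.
- move=> /asboolP[p pP ->] /asboolP[q qP ->]; apply/asboolP.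
  by exists (p - q); rewrite ?rpredB // rmorphB !hornerE.
- move=> /asboolP[p pP ->] /asboolP[q qP ->]; apply/asboolP.
  by exists (p * q); rewrite ?rpredM // rmorphM hornerM.
Qed.

HB.instance Definition _ := GRing.isSubringClosed.Build L adjoin_pred adjoin_subring.

Definition adjoin := subfring adjoin_pred.

Lemma adjoin_gen_subproof : z \in adjoin_pred.
Proof. by apply/asboolP; exists 'X; rewrite ?polyOverX // map_polyX hornerX. Qed.

Definition adjoin_gen : adjoin := SubFRing adjoin_gen_subproof.

Lemma adjoin_const_subproof (r : subfring P) : (sfval r)%:A \in adjoin_pred.
Proof.
apply/asboolP; exists (sfval r)%:P; first by rewrite polyOverC; case: r.
by rewrite map_polyC hornerC.
Qed.

Definition adjoin_const (r : subfring P) : adjoin :=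
  SubFRing (adjoin_const_subproof r).

Lemma adjoin_const_zmod : zmod_morphism adjoin_const.
Proof. by move=> x y; apply: val_inj; rewrite /= scalerBl. Qed.

Lemma adjoin_const_monoid : monoid_morphism adjoin_const.
Proof.
split=> [|x y]; apply: val_inj => /=; first by rewrite scale1r.
by rewrite -scalerAl mul1r scalerA.
Qed.

HB.instance Definition _ :=
  GRing.isZmodMorphism.Build (subfring P) adjoin adjoin_const adjoin_const_zmod.
HB.instance Definition _ :=
  GRing.isMonoidMorphism.Build (subfring P) adjoin adjoin_const adjoin_const_monoid.

End Adjoin.

Section Ideals.
Variable A : idomainType.
Implicit Type I : set A.

Definition is_ideal I :=
  [/\ I 0, forall x y, I x -> I y -> I (x + y) & forall a x, I x -> I (a * x)].

Definition is_prime_ideal I :=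
  [/\ is_ideal I, ~ I 1 & forall x y, I (x * y) -> I x \/ I y].

Definition is_maximal_ideal I :=
  [/\ is_ideal I, ~ I 1 &
      forall J, is_ideal J -> I `<=` J -> ~ J 1 -> J = I].

Definition is_pid :=
  forall I, is_ideal I -> exists a, I = [set x | exists b, x = b * a].

Definition is_noetherian :=
  forall I, is_ideal I -> exists n (g : 'I_n -> A),
    I = [set x | exists b : 'I_n -> A, x = \sum_(i < n) b i * g i].

Definition is_integrally_closed :=
  forall x : {fraction A}, integralOver (@FracField.tofrac A) x ->
    exists a, x = FracField.tofrac a.

Definition is_dedekind :=
  [/\ is_noetherian, is_integrally_closed &
      forall I, is_prime_ideal I -> I <> [set 0] -> is_maximal_ideal I].

End Ideals.

(* A / (a) for a commutative ring A.  The quotient rings of the library require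
   a proper ideal, but here A / (a) can be zero: (zeta - 1) is the unit ideal
   when S contains all the places above l. *)

Section PrincipalQuotient.
Variables (A : comNzRingType) (a : A).

Definition princ_pred : {pred A} := fun x => `[< exists b, x = b * a >].

Lemma princ_zmod : zmod_closed princ_pred.
Proof.
split=> [|x y /asboolP[b ->] /asboolP[c ->]]; apply/asboolP.
  by exists 0; rewrite mul0r.
by exists (b - c); rewrite mulrBl.
Qed.

HB.instance Definition _ := GRing.isZmodClosed.Build A princ_pred princ_zmod.

Definition quo := Quotient.quot princ_pred.
HB.instance Definition _ := Choice.on quo.
HB.instance Definition _ := GRing.Zmodule.on quo.
HB.instance Definition _ := EqQuotient.on quo.

Definition quo_one : quo := \pi_quo 1.
Definition quo_mul (x y : quo) : quo := \pi_quo (generic_quotient.repr x * generic_quotient.repr y).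

Lemma quo_eqP (x y : A) :
  reflect (exists b, x - y = b * a) (\pi_quo x == \pi_quo y).
Proof.
rewrite -[_ == _]/(x == y %[mod Quotient.quot princ_pred]).
rewrite -Quotient.idealrBE; exact: asboolP.
Qed.

Lemma pi_quoB : {morph \pi_quo : x y / x - y}.
Proof. exact: (raddfB (\pi_(Quotient.quot princ_pred))). Qed.

Lemma pi_quoD : {morph \pi_quo : x y / x + y}.
Proof. exact: (raddfD (\pi_(Quotient.quot princ_pred))). Qed.

Lemma pi_quoM x y : \pi_quo (x * y) = quo_mul (\pi_quo x) (\pi_quo y).
Proof.
apply/eqP/quo_eqP.
set x' := generic_quotient.repr (\pi_quo x).
set y' := generic_quotient.repr (\pi_quo y).
have /eqP/quo_eqP[b bE] : \pi_quo x = \pi_quo x' by rewrite reprK.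
have /eqP/quo_eqP[c cE] : \pi_quo y = \pi_quo y' by rewrite reprK.
exists (b * y + x' * c).
rewrite mulrDl -mulrA [y * a]mulrC mulrA -bE -mulrA -cE.
by rewrite mulrBr mulrBl addrA subrK.
Qed.

Lemma quo_surj (q : quo) : exists x, q = \pi_quo x.
Proof. by exists (generic_quotient.repr q); rewrite reprK. Qed.

Lemma quo_mulA : associative quo_mul.
Proof.
move=> u v w.
have [x ->] := quo_surj u; have [y ->] := quo_surj v; have [z ->] := quo_surj w.
by rewrite -!pi_quoM mulrA.
Qed.

Lemma quo_mulC : commutative quo_mul.
Proof. by move=> x y; rewrite /quo_mul mulrC. Qed.

Lemma quo_mul1 : left_id quo_one quo_mul.
Proof. by move=> u; have [x ->] := quo_surj u; rewrite -pi_quoM mul1r. Qed.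

Lemma quo_mulDl : left_distributive quo_mul +%R.
Proof.
move=> u v w.
have [x ->] := quo_surj u; have [y ->] := quo_surj v; have [z ->] := quo_surj w.
by rewrite -pi_quoD -!pi_quoM mulrDl pi_quoD.
Qed.

HB.instance Definition _ :=
  GRing.Zmodule_isComPzRing.Build quo quo_mulA quo_mulC quo_mul1 quo_mulDl.

Definition toquo : A -> quo := \pi_quo.

Lemma toquo_zmod : zmod_morphism toquo. Proof. exact: pi_quoB. Qed.
Lemma toquo_monoid : monoid_morphism toquo.
Proof. by split=> // x y; exact: pi_quoM. Qed.

HB.instance Definition _ := GRing.isZmodMorphism.Build A quo toquo toquo_zmod.
HB.instance Definition _ := GRing.isMonoidMorphism.Build A quo toquo toquo_monoid.

End PrincipalQuotient.

Section Representations.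
Variables (A : comUnitRingType) (gT : finGroupType) (n : nat).
(* gT acts on columns, by left multiplication. *)
Variable r : gT -> 'M[A]_n.

Definition norm_ker : set 'cV[A]_n := [set m | (\sum_g r g) *m m = 0].

Definition aut_rep : set ('cV[A]_n -> 'cV[A]_n) :=
  [set f | [/\ linear f, bijective f & forall g m, f (r g *m m) = r g *m f m]].

End Representations.

Section CyclicModules.
Variables (K : fieldType) (L : fieldExtType K) (P : subringClosed K) (zeta : L).

Local Notation O := (subfring P).
Local Notation Oz := (adjoin P zeta).
Local Notation zetaO := (adjoin_gen P zeta).
Local Notation Oz_mod := (quo (zetaO - 1)).

Definition fractional_ideal (a : set L) :=
  [/\ [/\ a 0, forall x y, a x -> a y -> a (x + y) &
          forall (b : Oz) x, a x -> a (sfval b * x)],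
      exists2 x, a x & x != 0 &
      exists2 d : Oz, d != 0 & forall x, a x ->
        exists b : Oz, sfval d * x = sfval b].

Variables (gT : finGroupType) (gamma : gT) (iota : gT -> 'M[O]_3).
Local Notation M := 'cV[O]_3.

(* Here 'cV[K]_3 is M (x) K, and gamma acts on K * L as (1, zeta). *)
Definition generic_iso := exists h : {linear 'cV[K]_3 -> (K^o * L)%type},
  bijective h /\
  forall m, h (map_mx sfval (iota gamma) *m m) = ((h m).1, zeta * (h m).2).

Record ext_datum := ExtDatum {
  ed_ideal : set L;
  ed_idealP : fractional_ideal ed_ideal;
  (* an O[C_l]-isomorphism M_N ~ a; values outside M_N are irrelevant *)
  ed_iso : M -> L;
  ed_iso_bij : set_bij (norm_ker iota) ed_ideal ed_iso;
  ed_iso_linear : forall (a : O) (m m' : M),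
    norm_ker iota m -> norm_ker iota m' ->
    ed_iso (a *: m + m') = sfval a *: ed_iso m + ed_iso m';
  ed_iso_gamma : forall m, norm_ker iota m ->
    ed_iso (iota gamma *m m) = zeta * ed_iso m;
  (* M = M_N (+) O y *)
  ed_y : M;
  ed_y_span : forall m, exists a : O, norm_ker iota (m - a *: ed_y);
  ed_y_free : forall a : O, norm_ker iota (a *: ed_y) -> a = 0;
  (* an O[zeta]-isomorphism a / (zeta - 1) a ~ O[zeta] / (zeta - 1), given as
     a map on a *)
  ed_red : L -> Oz_mod;
  ed_red_linear : forall (b : Oz) (x x' : L), ed_ideal x -> ed_ideal x' ->
    ed_red (sfval b * x + x') = toquo (zetaO - 1) b * ed_red x + ed_red x';
  ed_red_surj : forall q, exists2 x, ed_ideal x & ed_red x = q;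
  ed_red_ker : forall x, ed_ideal x ->
    ed_red x = 0 <-> exists2 x', ed_ideal x' & x = (zeta - 1) * x' }.

Definition ext_beta (D : ext_datum) : L :=
  ed_iso D (iota gamma *m ed_y D - ed_y D).

Definition ext_class (D : ext_datum) : Oz_mod := ed_red D (ext_beta D).

(* f induces multiplication by p.1 on M_N and by p.2 on M / M_N *)
Definition induces (D : ext_datum) (f : M -> M) (p : Oz * O) :=
  (forall m, norm_ker iota m ->
     norm_ker iota (f m) /\ ed_iso D (f m) = sfval p.1 * ed_iso D m) /\
  (forall m, norm_ker iota (f m - p.2 *: m)).

Variable l : nat.
Local Notation O_mod := (quo (l%:R : O)).

(* The canonical map O / (l) -> O[zeta] / (zeta - 1); see red_lE. *)
Definition red_l (x : O_mod) : Oz_mod :=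
  toquo (zetaO - 1) (adjoin_const zeta (generic_quotient.repr x)).

(* phi c = c psi, where psi is the reduction mod l acting on O / (l), phi is
   the reduction mod zeta - 1 acting on O[zeta] / (zeta - 1), and
   c : O / (l) -> O[zeta] / (zeta - 1) is multiplication by c.  The canonical map
   red_l is always onto, but it need not be injective (K = Q(sqrt 5), l = 5,
   O = O_K); when it is bijective this is the same equality in End(O / (l)), see
   fibre_product_End. *)
Definition fibre_product (c : Oz_mod) : set (Oz * O) :=
  [set p | [/\ p.1 \is a GRing.unit, p.2 \is a GRing.unit &
    (fun x : O_mod => toquo (zetaO - 1) p.1 * (red_l x * c)) =
    (fun x : O_mod => red_l (toquo l%:R p.2 * x) * c)]].

Lemma l_in_zeta1 : (1 < l)%N -> l.-primitive_root zeta ->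
  exists b : Oz, l%:R = b * (zetaO - 1).
Proof.
move=> l1 zl.
have z1 : zeta != 1.
  by rewrite -[zeta]expr1 -(prim_order_dvd zl) dvdn1 neq_ltn l1 orbT.
have zO1 : zetaO - 1 != 0.
  by rewrite subr_eq0; apply: contra z1 => /eqP/(congr1 sfval)/= ->.
have zOl : zetaO ^+ l = 1.
  by apply: val_inj; rewrite [LHS]rmorphXn [RHS]rmorph1 /= prim_expr_order.
have s0 : \sum_(i < l) zetaO ^+ i = 0.
  by apply: (mulfI zO1); rewrite -subrX1 zOl subrr mulr0.
exists (\sum_(i < l) - \sum_(j < i) zetaO ^+ j).
have lE : l%:R = \sum_(i < l) (1 : Oz) by rewrite sumr_const card_ord.
rewrite mulr_suml -[LHS]subr0 -[X in _ - X = _]s0 lE -sumrB.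
by apply: eq_bigr => i _; rewrite mulNr mulrC -subrX1 opprB.
Qed.

Lemma red_lE (a : O) : (1 < l)%N -> l.-primitive_root zeta ->
  red_l (toquo l%:R a) = toquo (zetaO - 1) (adjoin_const zeta a).
Proof.
move=> l1 /(l_in_zeta1 l1)[b lE]; apply/eqP/quo_eqP.
set a' := generic_quotient.repr _.
have /eqP/quo_eqP[d aE] : toquo l%:R a' = toquo l%:R a by exact: reprK.
exists (adjoin_const zeta d * b).
by rewrite -rmorphB aE rmorphM rmorph_nat lE mulrA.
Qed.

Lemma fibre_product_End (c : Oz_mod) (e : Oz_mod -> O_mod) :
  (1 < l)%N -> l.-primitive_root zeta -> cancel red_l e -> cancel e red_l ->
  fibre_product c =
  [set p | [/\ p.1 \is a GRing.unit, p.2 \is a GRing.unit &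
    (fun x : O_mod => e (toquo (zetaO - 1) p.1) * (e c * x)) =
    (fun x : O_mod => e c * (toquo l%:R p.2 * x))]].
Proof.
move=> l1 zl redK eK.
have redM : {morph red_l : x y / x * y}.
  move=> x y; have [a ->] := quo_surj x; have [b ->] := quo_surj y.
  rewrite -!/(toquo _ _) -rmorphM !red_lE // rmorphM; exact: rmorphM.
apply/seteqP; split=> -[phi psi] [/= u v E]; split=> //=; apply/funext => x.
- apply: (can_inj redK); rewrite !redM !eK [c * red_l x]mulrC [c * _]mulrC.
  by have := congr1 (fun f => f x) E; rewrite /= redM.
- have := congr1 red_l (congr1 (fun f => f x) E).
  by rewrite /= !redM !eK [c * red_l x]mulrC [c * _]mulrC.
Qed.

End CyclicModules.

(* Main.v *)
(** An O[C_l]-automorphism f of M preserves M_N, and on M_N, identified with the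
    fractional ideal a, it is O[zeta]-linear, hence the multiplication by some phi
    in L with phi a <= a; since O[zeta] is noetherian and integrally closed, phi
    lies in O[zeta].  Write f y = psi y + n with n in M_N.  As gamma y = y + beta,
    the equation f (gamma y) = gamma (f y) reads

      phi beta = psi beta + (zeta - 1) n.

    Its solvability in n says that phi and psi agree on the class c of beta in
    a / (zeta - 1) a, and n is unique because zeta <> 1, so that (phi, psi)
    determines f. *)

From HB Require Import structures.
Require Import Defs.
From mathcomp Require Import all_boot all_order all_algebra all_fingroup.
From mathcomp Require Import all_field all_character.
From mathcomp Require Import boolp classical_sets functions reals exp.

Set Implicit Arguments.
Unset Strict Implicit.
Unset Printing Implicit Defensive.

Import Order.TTheory GRing.Theory Num.Theory.
Local Open Scope ring_scope.

(** * Multipliers of ideals in a noetherian integrally closed domain *)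

Section Multipliers.
Variables (A : idomainType) (I : set A).

(* The matrix of the multiplication by [u] on generators of [I] has [u] as an
   eigenvalue, so [u] is a root of its characteristic polynomial. *)
Lemma ideal_multiplier_integral (u : {fraction A}) :
  is_noetherian A -> is_ideal I -> (exists2 y, I y & y != 0) ->
  (forall x, I x ->
     exists2 x', I x' & u * FracField.tofrac x = FracField.tofrac x') ->
  integralOver (@FracField.tofrac A) u.
Proof.
move=> noethA idI [y Iy y0] uI; have [n [g IE]] := noethA I idI.
have Ig i : I (g i).
  rewrite IE; exists (fun j => (i == j)%:R).
  by rewrite (bigD1 i) //= eqxx mul1r big1 ?addr0 // => j /negPf;
     rewrite eq_sym => ->; rewrite mul0r.
have /boolp.choice[B BE] i : exists b : 'I_n -> A,
    u * FracField.tofrac (g i) = FracField.tofrac (\sum_j b j * g j).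
  by have [x'] := uI _ (Ig i); rewrite {1}IE => -[b ->]; exists b.
pose C := \matrix_(i, j) B j i.
exists (char_poly C); first exact: char_poly_monic.
rewrite map_char_poly -eigenvalue_root_char.
apply/eigenvalueP; exists (\row_i FracField.tofrac (g i)).
  apply/rowP => i; rewrite !mxE BE rmorph_sum; apply: eq_bigr => j _.
  by rewrite !mxE rmorphM mulrC.
apply: contra y0 => /eqP/rowP g0; move: Iy; rewrite IE => -[b ->].
rewrite big1 // => i _.
have /eqP := g0 i; rewrite !mxE tofrac_eq0 => /eqP ->.
by rewrite mulr0.
Qed.

Lemma ideal_multiplier (u : {fraction A}) :
  is_noetherian A -> is_integrally_closed A -> is_ideal I ->
  (exists2 y, I y & y != 0) ->
  (forall x, I x ->
     exists2 x', I x' & u * FracField.tofrac x = FracField.tofrac x') ->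
  exists a, u = FracField.tofrac a.
Proof. by move=> noethA icA idI I0 uI; exact/icA/ideal_multiplier_integral. Qed.

End Multipliers.

(** * Endomorphisms of fractional ideals *)

Section FractionalIdeals.
Variables (K : fieldType) (L : fieldExtType K) (P : subringClosed K) (zeta : L).

(** All ratios phi x / x agree, and their common value multiplies the integral ideal d a into
    itself, so it lies in O[zeta]. *)
Lemma fractional_ideal_end (a : set L) (phi : L -> L) :
  is_noetherian (adjoin P zeta) -> is_integrally_closed (adjoin P zeta) ->
  fractional_ideal P zeta a -> (forall x, a x -> a (phi x)) ->
  (forall (b : adjoin P zeta) x, a x -> phi (sfval b * x) = sfval b * phi x) ->
  exists b : adjoin P zeta, forall x, a x -> phi x = sfval b * x.
Proof.
move=> noeth ic [[a0 aD aM] [x0 ax0 x0N0] [d d0 da]] aphi phiM.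
have sfd0 : sfval d != 0 by rewrite -(inj_eq val_inj) in d0.
have [b0 b0E] := da _ ax0; have [c0 c0E] := da _ (aphi _ ax0).
have b00 : b0 != 0.
  by rewrite -(inj_eq val_inj) /= -b0E mulf_neq0.
(* With b = d x and b0 = d x0 in O[zeta], b x0 = b0 x; pulling the scalars b and b0 out of phi gives
   the claim. *)
have phiE x : a x -> x0 * phi x = phi x0 * x.
  move=> ax; have [b bE] := da _ ax; apply: (mulfI sfd0).
  have E1 : phi (sfval b * x0) = phi (sfval b0 * x).
    by congr phi; rewrite -bE -b0E; rewrite mulrAC.
  rewrite !phiM // -bE -b0E in E1.
  by rewrite mulrA -E1 mulrAC mulrA.
(* This is the ideal d a of O[zeta]. *)
pose I : set (adjoin P zeta) := fun b => exists2 x, a x & sfval b = sfval d * x.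
have idI : is_ideal I.
  split=> [|x y [x1 ax1 x1E] [y1 ay1 y1E]|b x [x1 ax1 x1E]].
  - by exists 0; rewrite ?mulr0.
  - by exists (x1 + y1); [exact: aD|rewrite [LHS]rmorphD /= x1E y1E mulrDr].
  - by exists (sfval b * x1); [exact: aM|rewrite [LHS]rmorphM /= x1E mulrCA].
(* The ratio phi x0 / x0, with both terms multiplied by d so that they become elements c0 and b0 of
   O[zeta]. *)
have [||t tE] := @ideal_multiplier _ I
  (FracField.tofrac c0 / FracField.tofrac b0) noeth ic idI.
- by exists b0 => //; exists x0.
- move=> x [x1 ax1 x1E]; have [c cE] := da _ (aphi _ ax1).
  exists c; first by exists (phi x1); [exact: aphi|].
  have tb0 : FracField.tofrac b0 != 0 by rewrite tofrac_eq0.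
  apply: (mulfI tb0); rewrite mulrA mulrCA mulfV // mulr1 -!rmorphM.
  congr FracField.tofrac; apply: val_inj; rewrite [LHS]rmorphM [RHS]rmorphM /=.
  by rewrite x1E -c0E -b0E -cE mulrACA -phiE // [in RHS]mulrACA.
exists t => x ax; apply: (mulfI x0N0); rewrite phiE // mulrCA mulrA; congr (_ * _).
apply: (mulfI sfd0); rewrite c0E mulrCA b0E.
have /eqP : FracField.tofrac c0 = FracField.tofrac (t * b0).
  by rewrite tofracM -tE divfK // tofrac_eq0.
by rewrite tofrac_eq => /eqP ->; exact: rmorphM.
Qed.

End FractionalIdeals.

(** Gives a bare function, such as a member of [aut_rep], its linear structure, so that the rules
    for linear maps apply. *)
Lemma linear_exists (R : nzRingType) (U V : lmodType R) (f : U -> V) :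
  linear f -> exists F : {linear U -> V}, f = F.
Proof.
move=> fl; pose F := GRing.isLinear.Build R U V *:%R f fl.
by exists (HB.pack_for {linear U -> V} f F).
Qed.

(** * The kernel of the norm as a submodule *)

Section NormKernel.
Variables (A : comUnitRingType) (gT : finGroupType) (n : nat).
Variable r : gT -> 'M[A]_n.
Local Notation NK := (norm_ker r).

Lemma norm_ker_lin a m m' : NK m -> NK m' -> NK (a *: m + m').
Proof.
by rewrite /norm_ker /= => m0 m'0; rewrite mulmxDr -scalemxAr m0 m'0 scaler0 add0r.
Qed.

Lemma norm_ker0 : NK 0.
Proof. by rewrite /norm_ker /= mulmx0. Qed.

Lemma norm_kerD m m' : NK m -> NK m' -> NK (m + m').
Proof. by move=> km km'; rewrite -[m]scale1r; apply: norm_ker_lin. Qed.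

Lemma norm_kerZ a m : NK m -> NK (a *: m).
Proof. by move=> km; rewrite -[_ *: m]addr0; apply: norm_ker_lin norm_ker0. Qed.

Lemma norm_kerN m : NK m -> NK (- m).
Proof. by move=> /(norm_kerZ (-1)); rewrite scaleN1r. Qed.

Lemma norm_kerB m m' : NK m -> NK m' -> NK (m - m').
Proof. by move=> km /norm_kerN; apply: norm_kerD. Qed.

Hypothesis r_repr : mx_repr [set: gT]%SET r.

(** N g = N in the group ring, by translating the sum, so N kills the image of g - 1. *)
Lemma norm_ker_subr g m : NK (r g *m m - m).
Proof.
rewrite /norm_ker /= mulmxBr mulmxA mulmx_suml.
rewrite [X in _ - X *m _](reindex_inj (mulIg g)) -mulmxBl -sumrB big1 ?mul0mx //.
by move=> h _; case: r_repr => _ ->; rewrite ?inE ?subrr.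
Qed.

Lemma norm_ker_act g m : NK m -> NK (r g *m m).
Proof. by move=> /(norm_kerD (norm_ker_subr g m)); rewrite subrK. Qed.

Lemma norm_ker_equivariant (f : 'cV[A]_n -> 'cV[A]_n) m :
  linear f -> (forall g m, f (r g *m m) = r g *m f m) -> NK m -> NK (f m).
Proof.
move=> /linear_exists[F ->] fr m0; rewrite /norm_ker /= mulmx_suml.
under eq_bigr => g _ do rewrite -fr.
by rewrite -raddf_sum -mulmx_suml m0 raddf0.
Qed.

Lemma cyclic_equivariant gamma (f : 'cV[A]_n -> 'cV[A]_n) :
  <[gamma]>%g = [set: gT]%SET ->
  (forall m, f (r gamma *m m) = r gamma *m f m) ->
  forall g m, f (r g *m m) = r g *m f m.
Proof.
move=> gen fr g m; have /cycleP[k ->] : g \in <[gamma]>%g by rewrite gen inE.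
have [r1 rM] := r_repr; elim: k => [|k IHk] in m *.
  by rewrite expg0 r1 !mul1mx.
by rewrite expgS rM ?inE // -!mulmxA fr IHk.
Qed.

End NormKernel.

(** * Composition and inversion of automorphisms *)

Lemma aut_rep_comp (A : comUnitRingType) (gT : finGroupType) n
    (r : gT -> 'M[A]_n) f g :
  aut_rep r f -> aut_rep r g -> aut_rep r (f \o g).
Proof.
move=> [fl fb fr] [gl gb gr]; split=> [a u v||h m] /=; first by rewrite gl fl.
  exact: bij_comp.
by rewrite gr fr.
Qed.

Lemma aut_rep_inv (A : comUnitRingType) (gT : finGroupType) n
    (r : gT -> 'M[A]_n) f :
  aut_rep r f -> exists g, [/\ aut_rep r g, cancel f g & cancel g f].
Proof.
move=> [fl [g fK gK] fr]; exists g; split=> //; split=> [a u v||h m].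
- by apply: (can_inj fK); rewrite fl !gK.
- by exists f.
- by apply: (can_inj fK); rewrite fr !gK.
Qed.

(** * Coordinates on M and the O[zeta]-structure of M_N *)

Section ExtensionData.
Variables (K : fieldType) (L : fieldExtType K) (P : subringClosed K) (zeta : L).
Variables (gT : finGroupType) (gamma : gT) (iota : gT -> 'M[subfring P]_3).
Hypothesis iota_repr : mx_repr [set: gT]%SET iota.
Variable D : ext_datum zeta gamma iota.

Local Notation O := (subfring P).
Local Notation Oz := (adjoin P zeta).
Local Notation M := 'cV[O]_3.
Local Notation NK := (norm_ker iota).
Local Notation ia := (ed_ideal D).
Local Notation iso := (ed_iso D).
Local Notation y := (ed_y D).

Lemma ed_iso_in m : NK m -> ia (iso m).
Proof. by case: (ed_iso_bij D) => iF _ _; exact: iF. Qed.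

Lemma ed_iso_inj m m' : NK m -> NK m' -> iso m = iso m' -> m = m'.
Proof. by case: (ed_iso_bij D) => _ iI _ km km'; apply: iI; rewrite inE. Qed.

Lemma ed_iso_inv : exists j : L -> M, forall x, ia x -> NK (j x) /\ iso (j x) = x.
Proof.
have [_ _ iS] := ed_iso_bij D.
have /boolp.choice[j jE] x : exists m, ia x -> NK m /\ iso m = x.
  have [/iS[m km mE]|ax] := pselect (ia x); first by exists m.
  by exists 0.
by exists j.
Qed.

Lemma ed_iso0 : iso 0 = 0.
Proof.
have /(_ 0 0 (norm_ker0 _) (norm_ker0 _)) := @ed_iso_linear _ _ _ _ _ _ _ D 1.
by rewrite !scale1r addr0 => /eqP; rewrite -subr_eq subrr eq_sym => /eqP.
Qed.

Lemma ed_isoZ a m : NK m -> iso (a *: m) = sfval a *: iso m.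
Proof.
by move=> km; rewrite -[a *: m]addr0 ed_iso_linear ?ed_iso0 ?addr0 //;
   exact: norm_ker0.
Qed.

Lemma ed_isoD m m' : NK m -> NK m' -> iso (m + m') = iso m + iso m'.
Proof.
by move=> km km'; rewrite -[m]scale1r ed_iso_linear // !scale1r.
Qed.

Lemma ed_isoB m m' : NK m -> NK m' -> iso (m - m') = iso m - iso m'.
Proof.
move=> km km'; rewrite -[m - m']addrC -scaleN1r ed_iso_linear //.
by rewrite rmorphN rmorph1 scaleN1r addrC.
Qed.

(** [q] is the projection of M onto M / M_N, read in the basis y. It is linear because the
    coefficient of y is unique. *)
Lemma ed_coord : exists q : M -> O,
  [/\ forall m, NK (m - q m *: y),
      forall a m, NK (m - a *: y) -> a = q m & scalar q].
Proof.
have /boolp.choice[q qE] := ed_y_span D.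
have qU a m : NK (m - a *: y) -> a = q m.
  move=> /norm_kerB/(_ (qE m)).
  rewrite addrC opprB addrA subrK addrC -scaleNr -scalerDl => /ed_y_free/eqP.
  by rewrite addrC subr_eq0 eq_sym => /eqP.
exists q; split=> // a u v; apply/esym/qU.
rewrite scalerDl -scalerA opprD addrACA -scalerBr; exact: norm_ker_lin.
Qed.

(** On M_N, zeta acts as gamma, with which f commutes, and b is a polynomial in zeta over O. *)
Lemma equivariant_zeta_linear f (b : Oz) m m' :
  linear f -> (forall m, NK m -> NK (f m)) ->
  (forall m, f (iota gamma *m m) = iota gamma *m f m) ->
  NK m -> NK m' -> iso m' = sfval b * iso m -> iso (f m') = sfval b * iso (f m).
Proof.
move=> /linear_exists[F ->] fNK fg.
(* [Q] carries its own preimage of b times [iso m], so it passes through sums, scalars and powers of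
   zeta; injectivity of [iso] identifies this preimage with the given m' at the end. *)
pose Q (b : L) := forall m, NK m ->
  exists2 m', NK m' & iso m' = b * iso m /\ iso (F m') = b * iso (F m).
have QD b1 b2 : Q b1 -> Q b2 -> Q (b1 + b2).
  move=> Q1 Q2 n kn; have [n1 k1 [E1 F1]] := Q1 n kn.
  have [n2 k2 [E2 F2]] := Q2 n kn; exists (n1 + n2); first exact: norm_kerD.
  rewrite raddfD !ed_isoD ?E1 ?E2 ?F1 ?F2 ?mulrDl //; exact: fNK.
have QZ (c : O) b1 : Q b1 -> Q (sfval c *: b1).
  move=> Q1 n kn; have [n1 k1 [E1 F1]] := Q1 n kn.
  exists (c *: n1); first exact: norm_kerZ.
  by rewrite linearZ !ed_isoZ ?E1 ?F1 ?scalerAl //; exact: fNK.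
have QX k : Q (zeta ^+ k).
  elim: k => [|k IHk] n kn; first by exists n; rewrite // !mul1r.
  have [n1 k1 [E1 F1]] := IHk n kn.
  exists (iota gamma *m n1); first exact: norm_ker_act.
  rewrite fg !ed_iso_gamma ?E1 ?F1 ?mulrA ?exprS //; exact: fNK.
have Q0 : Q 0.
  move=> n kn; exists 0; first exact: norm_ker0.
  by rewrite raddf0 ed_iso0 !mul0r.
have Qb (b' : Oz) : Q (sfval b').
  have /asboolP[p /polyOverP pP ->] := sfvalP b'.
  rewrite horner_coef; apply: (big_ind Q) => // i _.
  rewrite coef_map /= mulr_algl; exact: (QZ (SubFRing (pP i))).
move=> km km' m'E; have [m2 k2 [E2 F2]] := Qb b m km.
by rewrite -F2; congr (iso (F _)); apply: ed_iso_inj; rewrite // m'E E2.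
Qed.

(** * The pair induced by an automorphism *)

(** A nonzero element of a determines the first component, and the free generator y of M / M_N the
    second. *)
Lemma induces_uniq f p p' : induces D f p -> induces D f p' -> p = p'.
Proof.
case: p p' => [b a] [b' a'] [/= E1 F1] [/= E2 F2]; congr pair.
- have [_ [x ax x0] _] := ed_idealP D; have [j jE] := ed_iso_inv.
  have [kj xE] := jE x ax; apply: val_inj; apply: (mulIf x0); rewrite /= -xE.
  by rewrite -(E1 _ kj).2 -(E2 _ kj).2.
- have [q [qE qU _]] := ed_coord; apply/eqP; rewrite -subr_eq0; apply/eqP.
  apply: (@ed_y_free _ _ _ _ _ _ _ D); rewrite scalerBl.
  have := norm_kerB (F2 y) (F1 y).
  by rewrite addrC opprB addrA subrK addrC.
Qed.

Lemma induces_comp f g p p' :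
  linear f -> induces D f p -> induces D g p' -> induces D (f \o g) (p * p').
Proof.
move=> /linear_exists[F ->] [E1 F1] [E2 F2]; split=> [m km|m] /=.
  have [kg gE] := E2 m km; have [kfg fgE] := E1 _ kg; split=> //.
  by rewrite fgE gE mulrA -rmorphM.
have [k _] := E1 _ (F2 m).
have := norm_kerD (F1 (p'.2 *: m)) k.
by rewrite raddfB addrC addrA subrK scalerA.
Qed.

Lemma induces_id : induces D id 1.
Proof.
split=> [m km|m]; first by rewrite mul1r.
by rewrite scale1r subrr; exact: norm_ker0.
Qed.

(** phi comes from the endomorphism of a obtained by transporting f along [iso]; psi is the
    y-coordinate of f y. *)
Lemma aut_induces f :
  is_noetherian Oz -> is_integrally_closed Oz -> aut_rep iota f ->
  exists p, induces D f p.
Proof.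
move=> noeth ic [fl fb fr].
have fNK m : NK m -> NK (f m) by exact: norm_ker_equivariant.
have [j jE] := ed_iso_inv; have [q [qE qU ql]] := ed_coord.
have [[a0 aD aM] _ _] := ed_idealP D.
have [x ax|b x ax|b bE] :=
    @fractional_ideal_end _ _ _ _ ia (iso \o f \o j) noeth ic (ed_idealP D).
- by apply/ed_iso_in/fNK; case: (jE _ ax).
- have [kj E] := jE _ ax; have [kj' E'] := jE _ (aM b x ax).
  by apply: equivariant_zeta_linear => //; rewrite E E'.
exists (b, q (f y)); split=> [m km|m] /=.
  split; first exact: fNK.
  have ax := ed_iso_in km; have [kj E] := jE _ ax; rewrite -bE //=.
  by congr (iso (f _)); exact: ed_iso_inj.
have [F fF] := linear_exists fl; subst f.
(* For m = t + a y with t in M_N, f m - psi m = (f t - psi t) + a (f y - psi y), and both terms lie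
   in M_N. *)
set t := m - q m *: y; have kt : NK t := qE m.
have mE : m = t + q m *: y by rewrite subrK.
rewrite {1 2}mE.
have -> : F (t + q m *: y) = F t + q m *: F y by rewrite addrC fl addrC.
rewrite scalerDr opprD addrACA scalerA mulrC -scalerA -scalerBr.
apply: norm_kerD; last exact/norm_kerZ/qE.
by apply: norm_kerB; [exact: fNK|exact: norm_kerZ].
Qed.

(** Apply f to (gamma - 1) y, then write f y = psi y + n; on n in M_N, gamma - 1 acts as zeta -
    1. *)
Lemma induces_beta f p :
  aut_rep iota f -> induces D f p ->
  sfval p.1 * ext_beta D =
  sfval p.2 *: ext_beta D + (zeta - 1) * iso (f y - p.2 *: y).
Proof.
move=> [/linear_exists[G ->] _ fr] [E F].
have kb : NK (iota gamma *m y - y) by exact: norm_ker_subr.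
have kn := F y; set n := G y - _ in kn *.
rewrite /ext_beta -(E _ kb).2 mulrBl mul1r -ed_iso_gamma // -ed_isoB //; last first.
  exact: norm_ker_act.
rewrite -ed_iso_linear //; last exact: norm_ker_subr.
congr (iso _).
have -> : G (iota gamma *m y - y) = iota gamma *m G y - G y.
  by rewrite -fr raddfB.
rewrite -[G y](subrK (p.2 *: y)) -/n mulmxDr -scalemxAr scalerBr.
by rewrite opprD addrACA addrC.
Qed.

(** * Construction of automorphisms from compatible pairs *)

(** As M is the direct sum of M_N and the free module O y, a linear map can be prescribed on each
    summand separately. *)
Lemma ed_extend (b : Oz) (u : M) :
  exists F : {linear M -> M},
    (forall m, NK m -> NK (F m) /\ iso (F m) = sfval b * iso m) /\ F y = u.
Proof.
have [j jE] := ed_iso_inv; have [q [qE qU ql]] := ed_coord.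
have [[a0 aD aM] _ _] := ed_idealP D.
pose h m := j (sfval b * iso m).
have hE m : NK m -> NK (h m) /\ iso (h m) = sfval b * iso m.
  by move=> km; exact/jE/aM/ed_iso_in.
have hl a m m' : NK m -> NK m' -> h (a *: m + m') = a *: h m + h m'.
  move=> km km'; have [k E] := hE _ km; have [k' E'] := hE _ km'.
  have [k'' E''] := hE _ (norm_ker_lin a km km').
  apply: ed_iso_inj => //; first exact: norm_ker_lin.
  by rewrite E'' !ed_iso_linear // E E' mulrDr scalerAr.
have h0 : h 0 = 0.
  have [k E] := hE _ (norm_ker0 iota).
  by apply: ed_iso_inj; rewrite ?E ?ed_iso0 ?mulr0 //; exact: norm_ker0.
clearbody h.
have [|F FE] := @linear_exists _ _ _ (fun m => h (m - q m *: y) + q m *: u).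
  move=> a v w; rewrite ql scalerDl -scalerA opprD addrACA -scalerBr.
  by rewrite hl // scalerDl -scalerA addrACA -scalerDr.
have {}FE m : F m = h (m - q m *: y) + q m *: u by rewrite -FE.
exists F; split=> [m km|]; rewrite FE.
  (* Elements of M_N have y-coordinate 0; below, y itself has coordinate 1. *)
  by rewrite -(qU 0 m) ?scale0r ?subr0 ?addr0 //; exact: hE.
rewrite -(qU 1 y) ?scale1r ?subrr ?h0 ?add0r //; exact: norm_ker0.
Qed.

(** The five lemma for M_N, M and M / M_N, done by hand: F is invertible on the submodule and on the
    quotient. *)
Lemma induces_bijective (F : {linear M -> M}) p :
  p.1 \is a GRing.unit -> p.2 \is a GRing.unit -> induces D F p -> bijective F.
Proof.
move=> u1 u2 [FN Fq]; rewrite -setTT_bijective.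
have [j jE] := ed_iso_inv; have [[_ _ aM] _ _] := ed_idealP D.
split=> // [v w _ _ vw|v _].
  apply/eqP; rewrite -subr_eq0; set m := v - w.
  have m0 : F m = 0 by rewrite linearB vw subrr.
  have km : NK m.
    have := norm_kerZ (- p.2^-1) (Fq m).
    by rewrite m0 sub0r scalerN scaleNr opprK scalerA mulVr // scale1r.
  have [_] := FN _ km; rewrite m0 ed_iso0 => /esym/eqP; rewrite mulf_eq0.
  rewrite (_ : (sfval p.1 == 0) = false) /= => [/eqP E|].
    apply/eqP/ed_iso_inj; rewrite // ?E ?ed_iso0 //; exact: norm_ker0.
  apply: contraTF u1 => /eqP p10; rewrite (_ : p.1 = 0) ?unitr0 //.
  exact: val_inj.
(* psi^-1 v is a preimage of v modulo M_N. The error F w - v lies in M_N, where F is onto, so it is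
   F t for some t in M_N, and w - t is a preimage. *)
pose w := p.2^-1 *: v.
have kw : NK (F w - v) by have := Fq w; rewrite scalerA mulrV // scale1r.
have [kt tE] := jE _ (aM p.1^-1 _ (ed_iso_in kw)); set t := j _ in kt tE.
exists (w - t) => //; have [kFt Ft] := FN _ kt.
have E : F t = F w - v.
  apply: ed_iso_inj => //; rewrite Ft tE mulrA.
  have -> : sfval p.1 * sfval p.1^-1 = 1 by rewrite -rmorphM mulrV ?rmorph1.
  by rewrite mul1r.
by rewrite linearB E opprB addrC subrK.
Qed.

(* The automorphism sends [y] to [p.2 y + n], where [n] in [M_N] corresponds to
   [x]. *)
Lemma induces_exists (p : Oz * O) x :
  <[gamma]>%g = [set: gT]%SET -> p.1 \is a GRing.unit -> p.2 \is a GRing.unit ->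
  ia x -> sfval p.1 * ext_beta D = sfval p.2 *: ext_beta D + (zeta - 1) * x ->
  exists2 f, aut_rep iota f & induces D f p.
Proof.
move=> gen u1 u2 ax pE; have [j jE] := ed_iso_inv.
have [[a0 aD aM] _ _] := ed_idealP D; have [kn nE] := jE _ ax.
move: (j x) kn nE => n kn nE; have [F [FN Fy]] := ed_extend p.1 (p.2 *: y + n).
have FE a t : F (a *: y + t) = a *: (p.2 *: y + n) + F t by rewrite linearP Fy.
have mE m : exists a t, NK t /\ m = a *: y + t.
  have [a kt] := ed_y_span D m; exists a, (m - a *: y).
  by split=> //; rewrite addrC subrK.
have F_ind : induces D F p.
  split=> // m; have [a [t [kt ->]]] := mE m; have [kFt _] := FN _ kt.
  rewrite FE !scalerDr !scalerA mulrC -(addrA _ (a *: n)) opprD addrACA subrr add0r.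
  apply: norm_kerD; last apply/norm_kerN/norm_kerZ => //.
  by apply: norm_kerD; first exact: norm_kerZ.
exists F => //; split; first exact: linearP.
  exact: induces_bijective F_ind.
apply: (cyclic_equivariant iota_repr gen) => m; have [a [t [kt ->]]] := mE m.
pose b := iota gamma *m y - y.
have kb : NK b by exact: norm_ker_subr.
(* Under [iso] this is the equation [pE], since gamma - 1 acts on n as multiplication by zeta -
   1. *)
have Fb : F b = p.2 *: b + (iota gamma *m n - n).
  have [kFb Fb] := FN _ kb; have kgn := norm_ker_subr iota_repr gamma n.
  apply: ed_iso_inj => //; first exact: norm_ker_lin.
  rewrite Fb pE ed_iso_linear // -[iso b]/(ext_beta D) ed_isoB //; last first.
    exact: norm_ker_act.
  by rewrite ed_iso_gamma // nE mulrBl mul1r.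
have Fgt : F (iota gamma *m t) = iota gamma *m F t.
  have [kFt Ft] := FN _ kt; have kgt := norm_ker_act iota_repr gamma kt.
  have [kFgt Fgt] := FN _ kgt; apply: ed_iso_inj => //; first exact: norm_ker_act.
  by rewrite Fgt (ed_iso_gamma D kt) (ed_iso_gamma D kFt) Ft mulrCA.
have Fgy : F (iota gamma *m y) = iota gamma *m (p.2 *: y + n).
  rewrite -(subrK y (iota gamma *m y)) -/b linearD Fb Fy mulmxDr -scalemxAr.
  by rewrite scalerBr addrACA !subrK.
by rewrite FE !mulmxDr -!scalemxAr linearP Fgt Fgy mulmxDr -scalemxAr.
Qed.

(** * Injectivity, and invertibility of the induced pair *)

(** By [induces_beta] the pair determines (zeta - 1) n, hence n and the image of y; on M_N the map
    is multiplication by phi. *)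
Lemma induces_inj f g p :
  zeta != 1 -> aut_rep iota f -> aut_rep iota g ->
  induces D f p -> induces D g p -> f = g.
Proof.
move=> z1 fa ga fp gp; have z10 : zeta - 1 != 0 by rewrite subr_eq0.
have fgy : f y = g y.
  apply: (addIr (- (p.2 *: y))); apply: ed_iso_inj; [exact: fp.2|exact: gp.2|].
  apply: (mulfI z10); apply: (addrI (sfval p.2 *: ext_beta D)).
  by rewrite -!induces_beta.
apply/funext => m; have [a km] := ed_y_span D m.
have [/linear_exists[F fF] _ _] := fa; have [/linear_exists[G gG] _ _] := ga.
have FGt : F (m - a *: y) = G (m - a *: y).
  have [kf E] := fp.1 _ km; have [kg E'] := gp.1 _ km.
  by rewrite -fF -gG; apply: ed_iso_inj; rewrite // E E'.
rewrite fF gG in fgy *.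
by rewrite -(subrK (a *: y) m) addrC !linearP FGt fgy.
Qed.

(** The inverse automorphism induces a pair too, and by uniqueness its product with p is the pair 1
    of the identity. *)
Lemma induces_unit f p :
  is_noetherian Oz -> is_integrally_closed Oz -> aut_rep iota f ->
  induces D f p -> p.1 \is a GRing.unit /\ p.2 \is a GRing.unit.
Proof.
move=> noeth ic fa fp; have [g [ga fK gK]] := aut_rep_inv fa.
have [p' gp'] := aut_induces noeth ic ga; have [gl _ _] := ga.
have /(induces_uniq induces_id) pE : induces D id (p' * p).
  by rewrite (_ : id = g \o f); [exact: induces_comp|apply/funext => m /=; rewrite fK].
split; apply/unitrPr; [exists p'.1|exists p'.2]; rewrite mulrC.
  exact: esym (congr1 fst pE).
exact: esym (congr1 snd pE).
Qed.

(** * Compatibility with the class c *)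

Lemma ext_betaP : ia (ext_beta D).
Proof. exact/ed_iso_in/norm_ker_subr. Qed.

(** [ed_red] is O[zeta]-linear with kernel (zeta - 1) a, so (b - b') c = 0 means that (b - b') beta
    lies in (zeta - 1) a. *)
Lemma ext_class_eqP (b b' : Oz) :
  toquo (adjoin_gen P zeta - 1) b * ext_class D =
    toquo (adjoin_gen P zeta - 1) b' * ext_class D <->
  exists2 x, ia x &
    sfval b * ext_beta D = sfval b' * ext_beta D + (zeta - 1) * x.
Proof.
have [[a0 _ aM] _ _] := ed_idealP D.
have red0 : ed_red D 0 = 0.
  have := ed_red_linear 1 a0 a0.
  by rewrite mulr0 addr0 rmorph1 mul1r => /eqP; rewrite -subr_eq subrr eq_sym => /eqP.
have redM : ed_red D (sfval (b - b') * ext_beta D) =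
    toquo (adjoin_gen P zeta - 1) (b - b') * ext_class D.
  rewrite -[_ * ext_beta D]addr0 ed_red_linear // ?red0 ?addr0 //.
  exact: ext_betaP.
have [k1 k2] := ed_red_ker (aM (b - b') _ ext_betaP).
have sE : sfval (b - b') * ext_beta D = sfval b * ext_beta D - sfval b' * ext_beta D.
  by rewrite -mulrBl; congr (_ * _); exact: rmorphB.
split=> [E|[x ax E]].
  have [|x ax xE] := k1; first by rewrite redM rmorphB mulrBl E subrr.
  by exists x; rewrite // -xE sE addrC subrK.
apply/eqP; rewrite -subr_eq0 -mulrBl -rmorphB -redM; apply/eqP/k2.
by exists x; rewrite // sE E addrC addKr.
Qed.

End ExtensionData.

(** At the class of a, both functions equal the image of a times their value at 1, so comparing them
    at 1 is enough. *)
Lemma fibre_productP (K : fieldType) (L : fieldExtType K) (P : subringClosed K)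
    (zeta : L) l (c : quo (adjoin_gen P zeta - 1)) p :
  (1 < l)%N -> l.-primitive_root zeta ->
  fibre_product l c p <->
  [/\ p.1 \is a GRing.unit, p.2 \is a GRing.unit &
    toquo (adjoin_gen P zeta - 1) p.1 * c =
    toquo (adjoin_gen P zeta - 1) (adjoin_const zeta p.2) * c].
Proof.
move=> l1 zl; pose pi := toquo (adjoin_gen P zeta - 1).
have redM a : red_l zeta (toquo l%:R p.2 * toquo l%:R a) =
    pi (adjoin_const zeta p.2) * pi (adjoin_const zeta a).
  rewrite -[toquo _ _ * _](rmorphM (toquo l%:R)) red_lE //.
  by rewrite (rmorphM (adjoin_const zeta)) (rmorphM (toquo _)).
split=> -[u1 u2 E]; split=> //.
  have := congr1 (fun f => f (toquo l%:R 1)) E.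
  rewrite /= redM red_lE // (rmorph1 (adjoin_const zeta)).
  by rewrite /pi (rmorph1 (toquo _)) mul1r mulr1.
apply/funext => x; have [a ->] := quo_surj x; rewrite -/(toquo _ _).
by rewrite redM red_lE // mulrCA E mulrCA mulrA.
Qed.

(** * The isomorphism onto the fibre product *)

Theorem lemma5p3 (R : realType) (K : fieldExtType rat) (S : place_set R K)
  (l : nat) (L : fieldExtType K) (zeta : L)
  (gT : finGroupType) (gamma : gT) (iota : gT -> 'M[Sint S]_3)
  (l_prime : prime l)
  (zetaP : l.-primitive_root zeta)
  (L_gen : <<1; zeta>>%VS = {:L}%VS)
  (L_deg : \dim {:L} = 2%N)
  (O_pid : is_pid (Sint S))
  (Oz_dedekind : is_dedekind (adjoin (Sint_pred S) zeta))
  (gT_cyclic : <[gamma]>%g = [set: gT]%SET)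
  (gT_order : #[gamma]%g = l)
  (iota_repr : mx_repr [set: gT]%SET iota)
  (iota_inj : injective iota)
  (M_generic : generic_iso zeta gamma iota)
  (D : ext_datum zeta gamma iota) :
  exists Phi : ('cV[Sint S]_3 -> 'cV[Sint S]_3) ->
               adjoin (Sint_pred S) zeta * Sint S,
    [/\ forall f, aut_rep iota f -> forall p, induces D f p <-> p = Phi f,
        forall f g, aut_rep iota f -> aut_rep iota g ->
          Phi (f \o g) = Phi f * Phi g &
        set_bij (aut_rep iota) (fibre_product l (ext_class D)) Phi].
Proof.
have [noeth ic _] := Oz_dedekind; have l1 := prime_gt1 l_prime.
have z1 : zeta != 1.
  by rewrite -[zeta]expr1 -(prim_order_dvd zetaP) dvdn1 neq_ltn l1 orbT.
have /boolp.choice[Phi PhiP] f : exists p, aut_rep iota f -> induces D f p.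
  (* [Phi] is defined on all functions, with the default value 1 off the automorphisms. *)
  have [fa|nfa] := pselect (aut_rep iota f); last by exists 1.
  by have [p fp] := aut_induces iota_repr D noeth ic fa; exists p.
exists Phi; split=> [f fa p|f g fa ga|].
- by split=> [fp|->]; [exact/(induces_uniq fp)/PhiP|exact: PhiP].
- apply: (@induces_uniq _ _ _ _ _ _ _ D (f \o g)).
    exact/PhiP/aut_rep_comp.
  by case: (fa) => fl _ _; apply: induces_comp; [|exact: PhiP|exact: PhiP].
have constE (b : Sint S) x : sfval (adjoin_const zeta b) * x = sfval b *: x.
  by rewrite /= mulr_algl.
split=> [f fa|f g|p].
- have fp := PhiP f fa; have [u1 u2] := induces_unit iota_repr noeth ic fa fp.
  apply/fibre_productP => //; split=> //; apply/ext_class_eqP => //.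
  (* The compatibility is witnessed by n = f y - psi y. *)
  exists (ed_iso D (f (ed_y D) - (Phi f).2 *: ed_y D)); first exact/ed_iso_in/fp.2.
  by rewrite constE; exact: induces_beta.
- rewrite !inE => fa ga fg; have fp := PhiP f fa; rewrite fg in fp.
  exact: (induces_inj iota_repr z1 fa ga fp (PhiP g ga)).
(* Conversely, the x witnessing phi c = psi c prescribes the n of an automorphism. *)
- move=> /fibre_productP[] // u1 u2 /ext_class_eqP[] // x ax.
  rewrite constE => E.
  have [f fa fp] := induces_exists iota_repr gT_cyclic u1 u2 ax E.
  by exists f => //; apply: induces_uniq fp; exact: PhiP.
Qed.
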